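(* Let $(W,S)$ be a Coxeter system and $X\subseteq W$. If $X$ is convex in the left weak order and has a unique maximal element under the left weak order, then $X$ is ascent-compatible.
   Context: $\ell$ is the Coxeter length. The left weak order: $x\le_{\mathsf L}y$ if some reduced word for $y$ contains a reduced word for $x$ as a suffix. $X$ is convex if for all $x,y\in X$ with $x\le_{\mathsf L}y$, every $z$ with $x\le_{\mathsf L}z\le_{\mathsf L}y$ lies in $X$. $s\in S$ is a (left) descent of $w$ if $\ell(sw)<\ell(w)$ and an ascent otherwise. A quadruple $(u,v,s,t)$ with $u,v\in W$, $s,t\in S$ is aligned if $s$ is an ascent of $u$, $t$ is an ascent of $v$, and $u^{-1}su=v^{-1}tv$. $X$ is ascent-compatible if for all $u,v\in X$ and $s,t\in S$ with $(u,v,s,t)$ aligned, $su\in X$ if and only if $tv\in X$.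
   Formalization: ''Has a unique maximal element'' is taken to include that every element of X lies below that maximal element; this is automatic for finite X, and without it the claim fails for some infinite X. *)

(* Defs.v *)
From HB Require Import structures.
From mathcomp Require Import all_boot monoid.
From mathcomp Require Import boolp classical_sets cardinality.
From mathcomp Require Import zify.

Set Implicit Arguments.
Unset Strict Implicit.
Unset Printing Implicit Defensive.

Import Algebra.

Local Open Scope classical_set_scope.
Local Open Scope group_scope.

Definition word (W : groupType) (S : set W) (ws : seq W) : Prop :=
  forall s, s \in ws -> S s.

Definition word_for (W : groupType) (S : set W) (w : W) (ws : seq W) : Prop :=
  word S ws /\ \prod_(s <- ws) s = w.

(* m s t = 0 encodes m(s, t) = oo; accordingly x ^+ 0 = 1 imposes no relation. *)
Definition coxeter_matrix (W : groupType) (S : set W) (m : W -> W -> nat) :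
    Prop :=
  forall s t, S s -> S t -> m s t = m t s /\ (m s t = 1%N <-> s = t).

Definition satisfies_relations (W : groupType) (S : set W) (m : W -> W -> nat)
    (G : groupType) (f : W -> G) : Prop :=
  forall s t, S s -> S t -> (f s * f t) ^+ m s t = 1.

(* W = < S | (s t) ^ m(s, t) = 1 >, the presentation being expressed by its
   universal property. The relations make every s in S an involution, so S
   generates W as a group iff every element of W is a product of elements
   of S. Only the values of f on S matter. *)
Definition coxeter_system (W : groupType) (S : set W) : Prop :=
  exists m : W -> W -> nat,
    [/\ coxeter_matrix S m,
        satisfies_relations S m (fun w : W => w),
        (forall w, exists ws, word_for S w ws) &
        (forall (G : groupType) (f : W -> G), satisfies_relations S m f ->
           exists g : {multiplicative W -> G}, forall s, S s -> g s = f s)].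

Definition is_length (W : groupType) (S : set W) (w : W) (n : nat) : Prop :=
  (exists2 ws, word_for S w ws & size ws = n) /\
  (forall ws, word_for S w ws -> (n <= size ws)%N).

(* Junk value 0 when w is not a product of elements of S, which does not
   occur in a Coxeter system. *)
Definition ell (W : groupType) (S : set W) (w : W) : nat :=
  xget 0%N [set n | is_length S w n].

Definition reduced_word (W : groupType) (S : set W) (w : W) (ws : seq W) :
    Prop :=
  word_for S w ws /\ size ws = ell S w.

Definition left_weak (W : groupType) (S : set W) (x y : W) : Prop :=
  exists p q : seq W, reduced_word S y (p ++ q) /\ reduced_word S x q.

Definition weak_convex (W : groupType) (S X : set W) : Prop :=
  forall x y, X x -> X y -> left_weak S x y ->
    forall z, left_weak S x z -> left_weak S z y -> X z.

Definition maximal (W : groupType) (S X : set W) (m : W) : Prop :=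
  X m /\ forall x, X x -> left_weak S m x -> x = m.

(* The second clause says that the unique maximal element is the maximum of X
   (see has_unique_maximalP). It is automatic when X is finite (see
   finite_has_unique_maximal), but not when X is infinite: if
   W = < a, b, c | a^2, b^2, c^2, (ac)^2 >, then
   X = {1, c, a, ba, aba, baba, ...} is convex and c is its only maximal
   element, while (1, a, c, c) is aligned, c * 1 is in X and c * a is not. *)
Definition has_unique_maximal (W : groupType) (S X : set W) : Prop :=
  (exists! m, maximal S X m) /\
  (forall x, X x -> exists2 m, maximal S X m & left_weak S x m).

Definition descent (W : groupType) (S : set W) (w s : W) : Prop :=
  S s /\ (ell S (s * w) < ell S w)%N.

Definition ascent (W : groupType) (S : set W) (w s : W) : Prop :=
  S s /\ ~ descent S w s.

Definition aligned (W : groupType) (S : set W) (u v s t : W) : Prop :=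
  [/\ ascent S u s, ascent S v t & u^-1 * s * u = v^-1 * t * v].

Definition ascent_compatible (W : groupType) (S X : set W) : Prop :=
  forall u v s t, X u -> X v -> aligned S u v s t -> (X (s * u) <-> X (t * v)).

Lemma left_weak_anti (W : groupType) (S : set W) (x y : W) :
  left_weak S x y -> left_weak S y x -> x = y.
Proof.
move=> [p [q [[[_ <-] sy] [[_ <-] sx]]]] [p' [q' [[_ sx'] [_ sy']]]].
move: sy sx'; rewrite !size_cat sy' -sx => sy sx'.
suff -> : p = [::] by [].
by apply: size0nil; lia.
Qed.

Lemma left_weak_trans (W : groupType) (S : set W) (x y z : W) :
  left_weak S x y -> left_weak S y z -> left_weak S x z.
Proof.
move=> [p [q [[[wy ey] sy] rx]]] [p' [q' [[[wz ez] sz] [[wq' eq'] sq']]]].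
exists (p' ++ p), q; split=> //; rewrite -catA; split; last first.
  by rewrite size_cat sy -sq' -size_cat.
split; last by rewrite big_cat /= ey -eq' -big_cat.
move=> s; rewrite mem_cat => /orP[sp'|]; last exact: wy.
by apply: wz; rewrite mem_cat sp'.
Qed.

Lemma has_unique_maximalP (W : groupType) (S X : set W) :
  has_unique_maximal S X <->
  exists2 m, X m & forall x, X x -> left_weak S x m.
Proof.
split=> [[[m [[Xm _] mU]] mB]|[m Xm mB]].
  by exists m => // x /mB[m' /mU <-].
have mm : maximal S X m.
  by split=> // x Xx mx; apply: left_weak_anti mx; apply: mB.
split; last by move=> x Xx; exists m => //; apply: mB.
exists m; split=> // m' [Xm' m'X]; exact/m'X/mB.
Qed.

Lemma left_weak_refl (W : groupType) (S : set W) (x : W) :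
  (exists ws, word_for S x ws) -> left_weak S x x.
Proof.
move=> [ws wsx].
have ex : exists n, `[< exists2 vs, word_for S x vs & size vs = n >].
  by exists (size ws); apply/asboolP; exists ws.
case: (ex_minnP ex) => n /asboolP[vs vsx <-] min_vs.
have lenx : is_length S x (size vs).
  split; first by exists vs.
  by move=> us usx; apply: min_vs; apply/asboolP; exists us.
have [[us usx sus] _] : is_length S x (ell S x) by apply: (xgetI 0%N lenx).
by exists [::], us.
Qed.

Lemma finite_has_unique_maximal (W : groupType) (S X : set W) :
  coxeter_system S -> finite_set X ->
  (exists! m, maximal S X m) -> has_unique_maximal S X.
Proof.
move=> [_ [_ _ gen _]] /finite_seqP[r rX] uX; split=> // x.
have [N leN] : exists N, forall y, X y -> (ell S y <= N)%N.
  exists (\max_(y <- r) ell S y) => y; rewrite rX /= => yr.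
  by apply: (@leq_bigmax_seq _ _ xpredT).
have [k] := ubnP (N - ell S x)%N.
elim: k x => // k IHk x ltk Xx.
have [mx|nmx] := pselect (maximal S X x).
  by exists x => //; apply: left_weak_refl (gen x).
have [y [Xy xy yx]] : exists y, [/\ X y, left_weak S x y & y <> x].
  apply: contrapT => noy; apply: nmx; split=> // y Xy xy.
  by apply: contrapT => yx; apply: noy; exists y.
have lt_xy : (ell S x < ell S y)%N.
  have [p [q [[[_ ey] sy] [[_ ex] sx]]]] := xy.
  move: sy; rewrite size_cat sx => <-.
  case: p ey => [|h p] ey; last by rewrite /=; lia.
  by case: yx; rewrite -ey -ex.
have [|m mm ym] := IHk y _ Xy; last by exists m => //; apply: left_weak_trans ym.
by have := leN _ Xy; lia.
Qed.

(* Main.v *)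
(** Let [r = u^-1 s u = v^-1 t v], so that [s u = u r] and [t v = v r], and let
    [m] be the maximum of [X].  By the strong exchange property, an element
    [y >= v] of the left weak order satisfies [t v <= y] as soon as [r] is a
    right inversion of [y].  If [s u] is in [X], then [s u <= m] makes [r] a
    right inversion of [m], hence [v <= t v <= m], and convexity puts [t v] in
    [X].  Inversions are handled by the parity cocycle [N w x], the number
    modulo 2 of occurrences of [x] among the reflections attached to a word for
    [w]; it does not depend on the word because it is the second component of
    a homomorphism from [W] to a semidirect product of [W] by [W -> bool]. *)
Require Import Defs.
From HB Require Import structures.
From mathcomp Require Import all_boot monoid.
From mathcomp Require Import boolp classical_sets.
From mathcomp Require Import zify.

Section ReflectionCocycle.

Import Algebra.
Local Open Scope group_scope.

(** * Semidirect product of [W] by the boolean functions on [W] *)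

Definition parity_ext (W : groupType) : Type := (W * (W -> bool))%type.

HB.instance Definition _ (W : groupType) := gen_eqMixin (parity_ext W).
HB.instance Definition _ (W : groupType) := gen_choiceMixin (parity_ext W).

(** Models concatenation of words: the reflections of the right factor are kept, and those of the
    left factor are conjugated by [b.1], all counted modulo 2. *)
Definition parity_mul (W : groupType) (a b : parity_ext W) : parity_ext W :=
  (a.1 * b.1, fun x => b.2 x (+) a.2 (x ^ b.1^-1)).
Definition parity_one (W : groupType) : parity_ext W := (1, fun=> false).
Definition parity_inv (W : groupType) (a : parity_ext W) : parity_ext W :=
  (a.1^-1, fun x => a.2 (x ^ a.1)).

Lemma parity_eq (W : groupType) (a b : parity_ext W) :
  a.1 = b.1 -> a.2 =1 b.2 -> a = b.
Proof. by case: a b => [a f] [b g] /= -> /funext ->. Qed.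

Lemma parity_mulA (W : groupType) : associative (@parity_mul W).
Proof.
move=> a b c; apply: parity_eq => [|x] /=; first by rewrite mulgA.
by rewrite invgM conjgM addbA.
Qed.

Lemma parity_mul1 (W : groupType) : left_id (@parity_one W) (@parity_mul W).
Proof. by move=> a; apply: parity_eq => [|x] /=; rewrite ?mul1g ?addbF. Qed.

Lemma parity_mulr1 (W : groupType) : right_id (@parity_one W) (@parity_mul W).
Proof.
by move=> a; apply: parity_eq => [|x] /=; rewrite ?mulg1 // invg1 conjg1.
Qed.

Lemma parity_mulV (W : groupType) :
  left_inverse (@parity_one W) (@parity_inv W) (@parity_mul W).
Proof.
move=> a; apply: parity_eq => [|x] /=; first by rewrite mulVg.
by rewrite conjgKV addbb.
Qed.

Lemma parity_mulrV (W : groupType) :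
  right_inverse (@parity_one W) (@parity_inv W) (@parity_mul W).
Proof.
move=> a; apply: parity_eq => [|x] /=; first by rewrite mulgV.
by rewrite invgK addbb.
Qed.

HB.instance Definition _ (W : groupType) := isGroup.Build (parity_ext W)
  (@parity_mulA W) (@parity_mul1 W) (@parity_mulr1 W)
  (@parity_mulV W) (@parity_mulrV W).

Definition parity_gen (W : groupType) (s : W) : parity_ext W :=
  (s, fun x => x == s).

(* The reflections attached to the word (s t)^k are t (s t)^i for i < 2 k. *)
Lemma parity_gen_expg (W : groupType) (s t : W) (k : nat) :
  s * s = 1 -> t * t = 1 ->
  (parity_gen W s * parity_gen W t) ^+ k =
  ((s * t) ^+ k,
   fun x => \big[addb/false]_(0 <= i < k.*2) (x == t * (s * t) ^+ i))
  :> parity_ext W.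
Proof.
move=> ss tt; have sV : s^-1 = s by exact: mulg1_eq.
have tV : t^-1 = t by exact: mulg1_eq.
have tst i : t * (s * t) ^+ i = (s * t) ^- i * t.
  rewrite -expVgn invgM sV tV; elim: i => [|i IHi]; first by rewrite mulg1 mul1g.
  by rewrite expgSr mulgA IHi expgSr !mulgA -[RHS]mulgA -[_ * t * s * t]mulgA.
elim: k => [|k IHk].
  by apply: parity_eq => // x /=; rewrite big_geq.
rewrite expgS IHk; apply: parity_eq => [|x] /=; first by rewrite expgS.
rewrite doubleS !big_nat_recr //= -addbA; congr (_ (+) _).
(* The extra factor [s * t] contributes [t] and [s ^ t], both conjugated by [(s * t) ^+ k]; by [tst]
   these are the terms of index [2k] and [2k + 1]. *)
have cj (y z w : W) : (y ^ z^-1 == w) = (y == w ^ z).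
  exact: can2_eq (conjgKV z) (conjgK z) y w.
rewrite !cj; congr addb.
- by rewrite conjgE mulgA -tst -mulgA -expgnDr addnn.
- congr (_ == _); rewrite !conjgE tV -addnn -addSn expgnDr expgSr !mulgA.
  by rewrite tst.
Qed.

(** * Words, lengths and reduced words *)

Lemma word_for_cat {W : groupType} {S : set W} {x y : W} {p q : seq W} :
  word_for S x p -> word_for S y q -> word_for S (x * y) (p ++ q).
Proof.
move=> [Sp <-] [Sq <-]; split; last by rewrite big_cat.
by move=> s; rewrite mem_cat => /orP[/Sp|/Sq].
Qed.

Lemma word_for_catP {W : groupType} {S : set W} {w : W} {p q : seq W} :
  word_for S w (p ++ q) ->
  exists x y, [/\ word_for S x p, word_for S y q & w = x * y].
Proof.
move=> [Spq <-]; exists (\prod_(s <- p) s), (\prod_(s <- q) s).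
by rewrite big_cat; split=> //; split=> // s si; apply: Spq;
  rewrite mem_cat si ?orbT.
Qed.

Lemma word_for1 {W : groupType} {S : set W} {s x : W} :
  word_for S x [:: s] <-> S s /\ x = s.
Proof.
rewrite /word_for big_seq1; split=> [[Ss <-]|[Ss ->]]; split=> //.
  by apply: Ss; rewrite mem_head.
by move=> t; rewrite mem_seq1 => /eqP->.
Qed.

Lemma ell_min {W : groupType} {S : set W} {w : W} {ws : seq W} :
  word_for S w ws -> is_length S w (ell S w).
Proof.
move=> wsw.
have ex : exists n, `[< exists2 vs, word_for S w vs & size vs = n >].
  by exists (size ws); apply/asboolP; exists ws.
case: (ex_minnP ex) => n /asboolP lenn minn.
apply: (xgetI 0%N (x := n)); split=> // us usw.
by apply: minn; apply/asboolP; exists us.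
Qed.

Lemma ell_le {W : groupType} {S : set W} {w : W} {ws : seq W} :
  word_for S w ws -> (ell S w <= size ws)%N.
Proof. by move=> wsw; have [_] := ell_min wsw; apply. Qed.

(** A word for [x] shorter than [q] could replace [q] and shorten the word for [y]. *)
Lemma reduced_suffix {W : groupType} {S : set W} {x y : W} {p q : seq W} :
  reduced_word S y (p ++ q) -> word_for S x q -> reduced_word S x q.
Proof.
move=> [ypq spq] xq; split=> //; have [[us xus sus] _] := ell_min xq.
have [a [b [ap bq yE]]] := word_for_catP ypq.
have {bq} bx : b = x by rewrite -bq.2 xq.2.
have := ell_le xq; have := ell_le (word_for_cat ap xus).
by rewrite -bx -yE -spq !size_cat sus bx; lia.
Qed.

Lemma coxeter_involution {W : groupType} {S : set W} {s : W} :
  coxeter_system S -> S s -> s * s = 1.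
Proof.
move=> [m [mcox mrel _ _]] Ss.
by rewrite -[s * s]expg1 -(mrel s s Ss Ss) (mcox s s Ss Ss).2.2.
Qed.

Lemma coxeter_reduced {W : groupType} {S : set W} (w : W) :
  coxeter_system S -> exists ws, reduced_word S w ws.
Proof.
move=> [_ [_ _ gen _]]; have [vs vsw] := gen w.
by have [[ws wsw sws] _] := ell_min vsw; exists ws.
Qed.

(** * The parity cocycle and strong exchange *)

Definition reflection_cocycle {W : groupType} (S : set W)
    (N : W -> W -> bool) : Prop :=
  (forall u v x, N (u * v) x = N v x (+) N u (x ^ v^-1)) /\
  (forall s x, S s -> N s x = (x == s)).

Lemma reflection_cocycle_exists {W : groupType} {S : set W} :
  coxeter_system S -> exists N, reflection_cocycle S N.
Proof.
move=> hWS; have [m [mcox mrel gen univ]] := hWS.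
have [|g gS] := univ (parity_ext W) (@parity_gen W).
  move=> s t Ss St; have invol x := @coxeter_involution _ _ x hWS.
  rewrite parity_gen_expg ?invol //; apply: parity_eq => [|x] /=.
    exact: mrel.
  (* Since [(s * t) ^+ m s t = 1], the second half of the sum repeats the first, and the two cancel
     modulo 2. *)
  rewrite -addnn (big_cat_nat (n := m s t)) ?leq_addr //=.
  rewrite -{2}[m s t]add0n big_addn addnK.
  under [X in _ (+) X]eq_bigr do rewrite expgnDr mrel // mulg1.
  by rewrite addbb.
(* With first component the identity of [W], the group law of [parity_ext] becomes the cocycle
   rule. *)
have g1 w : (g w).1 = w.
  have [ws] := gen w; elim: ws w => [|s ws IH] w.
    move=> [_ <-]; rewrite big_nil; apply: (mulgI (g 1).1).
    by rewrite mulg1 -[LHS]/(g 1 * g 1).1 -gmulfM mulg1.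
  rewrite -cat1s => /word_for_catP[x [y [/word_for1[Ss ->] /IH IHy ->]]].
  by rewrite gmulfM gS //= IHy.
exists (fun w => (g w).2); split=> [u v x|s x Ss].
  by rewrite gmulfM /= g1.
by rewrite gS.
Qed.

(* Strong exchange, without recording which letter is deleted. *)
Lemma inversion_shortens {W : groupType} {S : set W} {N : W -> W -> bool}
    {ws : seq W} {w x : W} :
  coxeter_system S -> reflection_cocycle S N -> word_for S w ws -> N w x ->
  exists2 us, word_for S (w * x) us & (size us < size ws)%N.
Proof.
move=> hWS [NM NS]; elim: ws w => [|s ws IH] w.
  have N1 y : N 1 y = false.
    by have := NM 1 1 y; rewrite mulg1 invg1 conjg1 addbb.
  by move=> [_ <-]; rewrite big_nil N1.
rewrite -cat1s => /word_for_catP[s' [w' [sw w'w ->]]].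
have [Ss ->] := word_for1.1 sw; rewrite NM (NS s) // => Nx.
have [Nw'|nNw'] := boolP (N w' x).
  have [us usw lt_us] := IH _ w'w Nw'; exists ([:: s] ++ us) => //.
  by rewrite -mulgA; apply: word_for_cat usw; apply/word_for1.
(* Here [x] is the reflection of the head letter, so multiplying by [x] deletes that letter. *)
move: Nx; rewrite (negbTE nNw') => /eqP xs.
exists ws => //; suff -> : s * w' * x = s * s * w'.
  by rewrite (coxeter_involution hWS Ss) mul1g.
by rewrite -{3}xs conjgE invgK !mulgA mulgVK.
Qed.

Lemma not_inversion {W : groupType} {S : set W} {N : W -> W -> bool}
    {w x : W} :
  coxeter_system S -> reflection_cocycle S N ->
  (ell S w <= ell S (w * x))%N -> N w x = false.
Proof.
move=> hWS hN le_w; apply/negbTE/negP => Nw.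
have [ws [wsw sws]] := coxeter_reduced w hWS.
have [us /ell_le le_us lt_us] := inversion_shortens hWS hN wsw Nw.
by lia.
Qed.

(** * Ascents, inversions and the weak order *)

Lemma ascent_ell_le {W : groupType} {S : set W} {u s : W} :
  ascent S u s -> (ell S u <= ell S (s * u))%N.
Proof.
by move=> [Ss ndes]; rewrite leqNgt; apply/negP => lt_su; apply: ndes.
Qed.

Lemma ascent_not_inversion {W : groupType} {S : set W} {N : W -> W -> bool}
    {u s : W} :
  coxeter_system S -> reflection_cocycle S N -> ascent S u s ->
  N u (u^-1 * s * u) = false.
Proof.
move=> hWS hN asc; apply: not_inversion hWS hN _.
by rewrite !mulgA mulgV mul1g; apply: ascent_ell_le.
Qed.

Lemma conj_reflection {W : groupType} (u s : W) :
  (u^-1 * s * u) ^ u^-1 = s.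
Proof. by rewrite conjgE invgK !mulgA mulgV mul1g mulgK. Qed.

(** Write [y = a * s * u]. The reflection is counted once, by the letter [s]: [u] does not count it
    because [s] is an ascent, and [a] does not because [a * s] is no shorter than [a]. *)
Lemma left_weak_inversion {W : groupType} {S : set W} {N : W -> W -> bool}
    {u s y : W} :
  coxeter_system S -> reflection_cocycle S N -> ascent S u s ->
  left_weak S (s * u) y -> N y (u^-1 * s * u).
Proof.
move=> hWS hN asc [p [q [[ypq spq] [suq sq]]]].
have [Ss _] := asc; have [NM NS] := hN.
have [a [b [ap bq yE]]] := word_for_catP ypq.
have {bq} bE : b = s * u by rewrite -bq.2 suq.2.
rewrite yE bE !NM (NS s) // (ascent_not_inversion hWS hN asc) invgM.
rewrite conjgM conj_reflection eqxx conjgE invgK mulgV mulg1 (not_inversion hWS hN) //.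
(* If [a * s] were shorter than [a], joining reduced words for [a * s] and [u] would beat the
   reduced word [p ++ q] for [y]. *)
have [us [uus sus]] := coxeter_reduced u hWS.
have [vs [avs svs]] := coxeter_reduced (a * s) hWS.
have := ell_le (word_for_cat avs uus); have := ell_le ap.
have := ascent_ell_le asc; have asu : a * s * u = y by rewrite yE bE mulgA.
by move: spq sq; rewrite asu !size_cat; lia.
Qed.

(** Write [y = a * v]. As [v] does not count the reflection, [a] has inversion [t], so [a * t] has a
    word shorter than [p]; inserting [t] before [q] restores [y] without exceeding its length. *)
Lemma inversion_left_weak {W : groupType} {S : set W} {N : W -> W -> bool}
    {v t y : W} :
  coxeter_system S -> reflection_cocycle S N -> ascent S v t ->
  left_weak S v y -> N y (v^-1 * t * v) ->
  left_weak S v (t * v) /\ left_weak S (t * v) y.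
Proof.
move=> hWS hN asc [p [q [[ypq spq] [vq sq]]]] Ny.
have [St _] := asc; have [NM _] := hN.
have [a [b [ap bq yE]]] := word_for_catP ypq.
have {bq} bE : b = v by rewrite -bq.2 vq.2.
have tt := coxeter_involution hWS St.
have Na : N a t.
  move: Ny; rewrite yE bE NM (ascent_not_inversion hWS hN asc).
  by rewrite conj_reflection.
have [us atus lt_us] := inversion_shortens hWS hN ap Na.
have tvq : word_for S (t * v) ([:: t] ++ q).
  by apply: word_for_cat vq; apply/word_for1.
have yus : word_for S y (us ++ [:: t] ++ q).
  suff -> : y = a * t * (t * v) by apply: word_for_cat.
  by rewrite yE bE !mulgA -[a * t * t]mulgA tt mulg1.
have ryus : reduced_word S y (us ++ [:: t] ++ q).
  split=> //; have := ell_le yus; rewrite -spq !size_cat /=; lia.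
have rtvq := reduced_suffix ryus tvq.
split; first by exists [:: t], q.
by exists us, ([:: t] ++ q).
Qed.

Lemma weak_convex_ascent {W : groupType} {S X : set W} {m u v s t : W} :
  coxeter_system S -> weak_convex S X -> X m ->
  (forall x, X x -> left_weak S x m) ->
  aligned S u v s t -> X v -> X (s * u) -> X (t * v).
Proof.
move=> hWS hconv Xm mB [ascu ascv ruv] Xv Xsu.
have [N hN] := reflection_cocycle_exists hWS.
have := left_weak_inversion hWS hN ascu (mB _ Xsu); rewrite ruv => Nm.
have [le_v_tv le_tv_m] := inversion_left_weak hWS hN ascv (mB _ Xv) Nm.
exact: hconv Xv Xm (mB _ Xv) _ le_v_tv le_tv_m.
Qed.

End ReflectionCocycle.

Theorem theorem3p3 (W : groupType) (S : set W) (hWS : coxeter_system S)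
    (X : set W) (hconv : weak_convex S X) (hmax : has_unique_maximal S X) :
  ascent_compatible S X.
Proof.
have [m Xm mB] := (has_unique_maximalP S X).1 hmax.
move=> u v s t Xu Xv al; have [ascu ascv ruv] := al; split.
  exact: weak_convex_ascent hWS hconv Xm mB al Xv.
(* Alignment is symmetric under exchanging [(u, s)] with [(v, t)]. *)
by apply: weak_convex_ascent hWS hconv Xm mB _ Xu; split.
Qed.
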